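(* Let $G$ be a finite simple undirected graph and let $\lambda$ be an integer. Then \begin{align*} m_A(G, \lambda) &\leq \theta(G)-\tau(G)+\mathrm{v}_\mathrm{o}(G)+2\mathrm{c}_\mathrm{e}(G)-\mathrm{c}(G)+2i(G) && \text{if $\lambda$ is even},\\ m_A(G, \lambda) &\leq \theta(G)-\tau(G)+\mathrm{v}_\mathrm{e}(G)+\mathrm{c}(G) && \text{if $\lambda$ is odd},\\ m_L(G, \lambda),\ m_Q(G, \lambda) &\leq \theta(G)-\tau(G)+\mathrm{c}(G) && \text{if $\lambda$ is even},\\ m_L(G, \lambda),\ m_Q(G, \lambda) &\leq \mathrm{v}(G)-\beta(G)-\mathrm{c}(G) && \text{if $\lambda$ is odd}. \end{align*}
   Context: For a graph $G$ with vertices $v_1,\dots,v_n$: $A(G)$ is the adjacency matrix, $D(G)$ the diagonal degree matrix, $L(G)=D(G)-A(G)$ the Laplacian, $Q(G)=D(G)+A(G)$ the signless Laplacian. For a real symmetric matrix $M(G)$, $m_M(G,\lambda)$ denotes the multiplicity of $\lambda$ as an eigenvalue of $M(G)$ (which is $0$ if $\lambda$ is not an eigenvalue), i.e. the dimension of the real kernel of $M(G)-\lambda I$. $\mathrm{v}(G)$, $\mathrm{e}(G)$, $\mathrm{c}(G)$ are the numbers of vertices, edges and connected components; $\mathrm{v}_\mathrm{e}(G)$ and $\mathrm{v}_\mathrm{o}(G)$ are the numbers of vertices of even and odd degree; a graph is even if all its vertices have even degree, and $\mathrm{c}_\mathrm{e}(G)$ is the number of connected components of $G$ that are even; $i(G)=0$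 if $G$ is even and $i(G)=1$ otherwise. The edge space is the $\mathbb{F}_2$-vector space of subsets of $E(G)$ under symmetric difference. The cycle space is the subspace of edge sets in which every vertex has even degree; its dimension $\theta(G)=\mathrm{e}(G)-\mathrm{v}(G)+\mathrm{c}(G)$ is the circuit rank. The cut space consists of all edge sets $\{uv\in E(G): u\in S, v\notin S\}$ for $S\subseteq V(G)$. The bicycle space is the intersection of the cycle space and the cut space; $\beta(G)$ is its dimension. A cycle is odd if it has an odd number of edges; two cycles are disjoint if they share no edge; $\tau(G)$ is the maximum cardinality of a set of pairwise (edge-)disjoint odd cycles of $G$. *)

(* Defs.v *)
From HB Require Import structures.
From mathcomp Require Import all_boot all_order all_algebra.
From mathcomp Require Import reals.

Set Implicit Arguments.
Unset Strict Implicit.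
Unset Printing Implicit Defensive.

Import Order.TTheory GRing.Theory Num.Theory.

Local Open Scope ring_scope.

Lemma mem_span_F2 (V : vectType 'F_2) (s : seq V) :
  0 \in s -> {in s &, forall x y, x + y \in s} -> <<s>>%VS =i s.
Proof.
move=> s0 sD x; apply/idP/idP => [xs|]; last exact: memv_span.
rewrite (@coord_span _ _ _ (in_tuple s) x xs).
elim/big_ind: _ => [//|y z ys zs|i _]; first exact: sD.
case: (coord _ _ _) => [[|[|//]] lt2].
  by rewrite [Ordinal _](_ : _ = 0) ?scale0r //; apply: val_inj.
rewrite [Ordinal _](_ : _ = 1) ?scale1r; last exact: val_inj.
exact: mem_nth.
Qed.

Section Graph.

(* A simple graph is a symmetric irreflexive relation e on a finite type T of
   vertices; the definitions take only T and e, the two properties of e being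
   hypotheses of the statements that use them. *)
Variables (T : finType) (e : rel T).

Definition edges : {set {set T}} :=
  [set f | [exists u, exists v, e u v && (f == [set u; v])]].

Definition degree (x : T) : nat := #|[set y | e x y]|.

Definition components : {set {set T}} := equivalence_partition (connect e) setT.

Definition nb_components : nat := #|components|.

Definition nb_even_components : nat :=
  #|[set C in components | [forall x in C, ~~ odd (degree x)]]|.

Definition nb_even_vertices : nat := #|[set x | ~~ odd (degree x)]|.

Definition nb_odd_vertices : nat := #|[set x | odd (degree x)]|.

Definition even_graph : bool := [forall x, ~~ odd (degree x)].

Definition non_even_index : nat := ~~ even_graph.

(* A set of edges is an F : {set {set T}} with F \subset edges. The edge space
   is the space of functions from the edges to F_2, in which F is represented
   by its indicator function, so that addition is symmetric difference. *)
Definition edge_space := {ffun {f : {set T} | f \in edges} -> ('F_2)^o}.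

Definition indicator (F : {set {set T}}) : edge_space :=
  [ffun f => (val f \in F)%:R].

Definition even_edge_set (F : {set {set T}}) : bool :=
  [forall x, ~~ odd #|[set f in F | x \in f]|].

Definition cut (U : {set T}) : {set {set T}} :=
  [set f in edges | [exists u in U, exists v in ~: U, f == [set u; v]]].

(* The sets of vectors spanned in the next two definitions are already closed
   under addition: see mem_cycle_space and mem_cut_space. *)
Definition cycle_space : {vspace edge_space} :=
  <<[seq indicator F | F in [set F in powerset edges | even_edge_set F]]>>%VS.

Definition cut_space : {vspace edge_space} :=
  <<[seq indicator (cut U) | U : {set T}]>>%VS.

Definition symdiff (F F' : {set {set T}}) := (F :\: F') :|: (F' :\: F).

Lemma indicator_symdiff F F' :
  indicator (symdiff F F') = indicator F + indicator F'.
Proof.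
apply/ffunP => f; rewrite !ffunE !inE.
by case: (_ \in F); case: (_ \in F'); apply: val_inj.
Qed.

Lemma indicator0 : indicator set0 = 0.
Proof. by apply/ffunP => f; rewrite !ffunE inE. Qed.

Lemma indicator_inj : {in powerset edges &, injective indicator}.
Proof.
move=> F F'; rewrite !inE => sF sF' eqFF'; apply/setP => f.
have [fE|fE] := boolP (f \in edges); last first.
  by rewrite (contraNF (subsetP sF f) fE) (contraNF (subsetP sF' f) fE).
have /ffunP/(_ (Sub f fE)) := eqFF'; rewrite !ffunE /=.
by case: (f \in F); case: (f \in F').
Qed.

Lemma even_symdiff F F' :
  even_edge_set F -> even_edge_set F' -> even_edge_set (symdiff F F').
Proof.
move=> /forallP eF /forallP eF'; apply/forallP => x.
have E (G : {set {set T}}) : [set f in G | x \in f] = G :&: [set f : {set T} | x \in f].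
  by apply/setP => f; rewrite !inE.
move: (eF x) (eF' x); rewrite !E; set X := finset _ => oF oF'.
have -> : symdiff F F' :&: X
    = ((F :&: X) :\: (F' :&: X)) :|: ((F' :&: X) :\: (F :&: X)).
  by apply/setP => f; rewrite !inE; case: (f \in F); case: (f \in F'); case: (x \in f).
rewrite cardsU (_ : (_ :\: _) :&: _ = set0); last first.
  by apply/setP => f; rewrite !inE; case: (f \in F); case: (f \in F'); case: (x \in f).
rewrite cards0 subn0 oddD.
move: oF oF'; rewrite -(cardsID (F' :&: X) (F :&: X)) -(cardsID (F :&: X) (F' :&: X)).
rewrite !oddD (setIC (F' :&: X)).
by case: (odd _); case: (odd _); case: (odd _).
Qed.

Lemma cut_symdiff (U U' : {set T}) :
  cut ((U :\: U') :|: (U' :\: U)) = symdiff (cut U) (cut U').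
Proof.
have cutE (W : {set T}) u v : [set u; v] \in edges ->
    ([set u; v] \in cut W) = ((u \in W) (+) (v \in W)).
  move=> uvE; rewrite inE uvE /=; apply/existsP/idP => [[a /andP[aW]]|].
    case/existsP => b /andP[]; rewrite inE => bW /eqP uvab.
    have : a \in [set u; v] by rewrite uvab !inE eqxx.
    have : b \in [set u; v] by rewrite uvab !inE eqxx orbT.
    have : u \in [set a; b] by rewrite -uvab !inE eqxx.
    have : v \in [set a; b] by rewrite -uvab !inE eqxx orbT.
    rewrite !inE => /orP[] /eqP -> /orP[] /eqP -> //.
    - by rewrite !orbb => /eqP ba; move: bW; rewrite ba aW.
    - by rewrite (negbTE bW) aW.
    - by rewrite (negbTE bW) aW.
    by rewrite !orbb => _ /eqP ba; move: bW; rewrite -ba aW.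
  have [uW /= vW|uW /= vW] := boolP (u \in W).
    by exists u; rewrite uW; apply/existsP; exists v; rewrite inE vW eqxx.
  exists v; rewrite vW; apply/existsP; exists u.
  by rewrite inE uW setUC eqxx.
apply/setP => f; have [fE|fE] := boolP (f \in edges); last first.
  have cutN W : (f \in cut W) = false by rewrite inE (negbTE fE).
  by rewrite in_setU !in_setD !cutN.
have [u [v fuv]] : exists u v, f = [set u; v].
  by move: fE; rewrite inE => /existsP[u /existsP[v /andP[_ /eqP]]]; exists u, v.
rewrite fuv in fE *; rewrite in_setU !in_setD !cutE // !inE.
by case: (u \in U); case: (v \in U); case: (u \in U'); case: (v \in U').
Qed.

Lemma mem_cycle_space (F : {set {set T}}) : F \subset edges ->
  (indicator F \in cycle_space) = even_edge_set F.
Proof.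
move=> sF; rewrite mem_span_F2; first 1 last.
- rewrite -indicator0; apply: image_f; rewrite !inE sub0set /=.
  apply/forallP => x; rewrite (_ : [set _ in _ | _] = set0) ?cards0 //.
  by apply/setP => f; rewrite !inE.
- move=> _ _ /imageP[A + ->] /imageP[B + ->]; rewrite !inE.
  move=> /andP[sA eA] /andP[sB eB]; rewrite -indicator_symdiff; apply: image_f.
  rewrite !inE even_symdiff // andbT /symdiff subUset.
  by rewrite !(subset_trans (subsetDl _ _)).
apply/imageP/idP => [[A + /indicator_inj]|eF]; last by exists F; rewrite ?inE ?sF.
by rewrite !inE => /andP[sA eA] ->; rewrite ?inE.
Qed.

Lemma mem_cut_space (F : {set {set T}}) : F \subset edges ->
  (indicator F \in cut_space) = [exists U, F == cut U].
Proof.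
have scut U : cut U \subset edges.
  by apply/subsetP => f; rewrite inE => /andP[].
move=> sF; rewrite mem_span_F2; first 1 last.
- have <- : indicator (cut set0) = 0; last exact: image_f.
  rewrite -indicator0; congr indicator; apply/setP => f; rewrite !inE.
  by apply/negP => /andP[_ /existsP[u]]; rewrite inE.
- move=> _ _ /imageP[A _ ->] /imageP[B _ ->].
  by rewrite -indicator_symdiff -cut_symdiff; apply: image_f.
apply/imageP/existsP => [[U _ /indicator_inj]|[U /eqP ->]]; last by exists U.
by move=> ->; rewrite ?inE ?scut //; exists U.
Qed.

Definition bicycle_space : {vspace edge_space} :=
  (cycle_space :&: cut_space)%VS.

Definition circuit_rank : nat := \dim cycle_space.

Definition bicycle_dim : nat := \dim bicycle_space.

(* A cycle is identified with its set of edges; as the vertices in the cyclic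
   sequence p are distinct, bounding its length n by #|T| loses nothing. *)
Definition is_cycle (F : {set {set T}}) : bool :=
  [exists n : 'I_#|T|.+1, exists p : n.-tuple T,
    [&& (2 < n)%N, ucycleb e p & F == [set [set x; next p x] | x in p]]].

Definition odd_cycle (F : {set {set T}}) : bool := is_cycle F && odd #|F|.

Definition odd_cycle_packing (P : {set {set {set T}}}) : bool :=
  [forall F in P, odd_cycle F] && trivIset P.

Definition odd_cycle_packing_number : nat :=
  \max_(P : {set {set {set T}}} | odd_cycle_packing P) #|P|.

Variable R : realType.

Definition adjacency_mx : 'M[R]_#|T| :=
  \matrix_(i, j) (e (enum_val i) (enum_val j))%:R.

Definition degree_mx : 'M[R]_#|T| :=
  diag_mx (\row_i (degree (enum_val i))%:R).

Definition laplacian_mx : 'M[R]_#|T| := degree_mx - adjacency_mx.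

Definition signless_laplacian_mx : 'M[R]_#|T| := degree_mx + adjacency_mx.

End Graph.

Definition multiplicity (R : realType) (n : nat) (M : 'M[R]_n) (a : R) : nat :=
  \rank (eigenspace M a).

(* Main.v *)
(* The rank of an integer matrix does not decrease when F_2 is replaced by R, so
   it is enough to bound kernels over F_2, where all matrices of the theorem are
   A + diagonal and L = Q is the composite of the coboundary (whose image is the
   cut space and whose kernel has dimension c) with the boundary (whose kernel is
   the cycle space). Hence dim ker L = c + beta.
   Pairing with tau disjoint odd cycles maps the cycle space onto F_2^tau and
   kills the cuts, so beta + tau <= theta.
   The kernels of L and L + I meet trivially, so dim ker (L + I) <= v - c - beta.
   A + I agrees with L on the vectors that vanish on the even vertices, so
   dim ker (A + I) <= dim ker L + v_e.
   A agrees with L on the vectors that vanish on the odd vertices. This gives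
   dim ker A <= dim ker L + v_o with a gain of c - c_e on both terms: the
   indicators of the non-even components lie in ker L and do not vanish on the odd
   vertices, and, since A is symmetric and maps the indicator of a component to
   the set of its odd vertices, a vector of ker A sums to 0 over the odd vertices
   of each component. *)

Require Import Defs.
From HB Require Import structures.
From mathcomp Require Import all_boot all_order all_algebra.
From mathcomp Require Import reals.
From mathcomp Require Import zify.

Import Order.TTheory GRing.Theory Num.Theory.
Local Open Scope ring_scope.

Set Implicit Arguments.
Unset Strict Implicit.
Unset Printing Implicit Defensive.

(* A nonzero minor mod 2 is an odd minor over the integers. *)
Lemma mxrank_int_F2 (R : numFieldType) (m n : nat) (A : 'M[int]_(m, n)) :
  (\rank (map_mx intr A : 'M['F_2]_(m, n))
     <= \rank (map_mx intr A : 'M[R]_(m, n)))%N.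
Proof.
set A2 : 'M['F_2]_(m, n) := map_mx _ A.
have full2 : row_full (rowsub (maxrankfun A2) A2)^T.
  by rewrite /row_full mxrank_tr; apply: maxrowsub_free.
pose f := maxrankfun A2; pose g := fullrankfun full2.
(* [f] picks independent rows modulo 2 and [g] then picks columns, so [B] is the transpose of a
   square submatrix of [A] that is invertible modulo 2. *)
pose B : 'M[int]_(\rank A2) := rowsub g (rowsub f A)^T.
have : (map_mx intr B : 'M['F_2]_(\rank A2)) \in unitmx.
  by have := fullrowsub_unit full2; rewrite /B map_mxsub -map_trmx map_mxsub.
rewrite unitmxE det_map_mx unitfE => det2.
have : (map_mx intr B : 'M[R]_(\rank A2)) \in unitmx.
  rewrite unitmxE det_map_mx unitfE intr_eq0.
  by apply: contraNneq det2 => ->.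
rewrite -row_full_unit => /eqP <-.
rewrite /B map_mxsub -map_trmx map_mxsub.
apply: leq_trans (mxrankS (rowsub_sub _ _)) _.
by rewrite mxrank_tr mxrankS // rowsub_sub.
Qed.

(** * Linear maps between function spaces on finite types *)

Section FfunLin.
Variables (F : fieldType).

Section Def.
Variables (I J : finType) (m : J -> I -> F).

(** Coefficients indexed by arbitrary finite types serve vertices, edges, components and cycles
    without enumerations, in the format of [edge_space]. *)
Definition ffun_lin_fun (x : {ffun I -> F^o}) : {ffun J -> F^o} :=
  [ffun j => \sum_i m j i * x i].

Lemma ffun_lin_is_linear : linear ffun_lin_fun.
Proof.
move=> a x y; apply/ffunP => j; rewrite !ffunE scaler_sumr -big_split /=.
by apply: eq_bigr => i _; rewrite !ffunE mulrDr /= scalerAr.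
Qed.

HB.instance Definition _ :=
  GRing.isLinear.Build F _ _ _ ffun_lin_fun ffun_lin_is_linear.

Definition ffun_lin : 'Hom({ffun I -> F^o}, {ffun J -> F^o}) :=
  linfun ffun_lin_fun.

Lemma ffun_linE x j : ffun_lin x j = \sum_i m j i * x i.
Proof. by rewrite lfunE ffunE. Qed.

End Def.

Lemma dim_ffun (I : finType) : dim {ffun I -> F^o} = #|I|.
Proof. exact: muln1. Qed.

Lemma lker_ffunP (I J : finType) (x : {ffun I -> F^o})
    (f : 'Hom({ffun I -> F^o}, {ffun J -> F^o})) :
  reflect (forall j, f x j = 0) (x \in lker f).
Proof.
rewrite memv_ker; apply: (iffP eqP) => [-> j|f0]; first by rewrite ffunE.
by apply/ffunP => j; rewrite f0 ffunE.
Qed.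

Lemma dim_ffunv (I : finType) (U : {vspace {ffun I -> F^o}}) :
  (\dim U <= #|I|)%N.
Proof. by rewrite -dim_ffun -dimvf dimvS ?subvf. Qed.

Lemma ffun_fullv (I : finType) (U : {vspace {ffun I -> F^o}}) :
  (forall i, [ffun j => (j == i)%:R] \in U) -> U = fullv.
Proof.
move=> dU; apply/vspaceP => x; rewrite memvf.
rewrite (_ : x = \sum_i x i *: [ffun j => (j == i)%:R : F^o]).
  by apply: memv_suml => i _; apply: memvZ.
apply/ffunP => j; rewrite sum_ffunE (bigD1 j) //= big1 ?addr0.
  by rewrite !ffunE eqxx [RHS]mulr1.
by move=> i ij; rewrite !ffunE eq_sym (negbTE ij) [LHS]mulr0.
Qed.

(** The rank factorisation of the matrix factors the map through a space whose dimension is the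
    rank. *)
Lemma dim_limg_rank (T : finType) (m : T -> T -> F) :
  (\dim (limg (ffun_lin m)) <=
     \rank (\matrix_(i < #|T|, j < #|T|) m (enum_val i) (enum_val j)))%N.
Proof.
set M := \matrix_(_, _) _.
pose B (j : 'I_(\rank M)) v := row_base M j (enum_rank v).
pose C v (j : 'I_(\rank M)) := col_base M (enum_rank v) j.
have -> : ffun_lin m = (ffun_lin C \o ffun_lin B)%VF.
  apply/lfunP => x; apply/ffunP => v; rewrite comp_lfunE !ffun_linE.
  under [RHS]eq_bigr do rewrite ffun_linE big_distrr /=.
  rewrite exchange_big /=; apply: eq_bigr => w _.
  under eq_bigr do rewrite mulrA.
  rewrite -big_distrl /=; congr (_ * _).
  have /matrixP/(_ (enum_rank v) (enum_rank w)) := mulmx_base M.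
  by rewrite !mxE !enum_rankK => <-.
rewrite limg_comp.
have /leq_trans -> // : (\dim (ffun_lin C @: limg (ffun_lin B))
                           <= \dim (limg (ffun_lin B)))%N.
  by rewrite -[leqRHS](limg_ker_dim (ffun_lin C)) leq_addl.
by apply: leq_trans (dim_ffunv _) _; rewrite card_ord.
Qed.

End FfunLin.

(** The multiplicity is the nullity of the integer matrix [A - a], whose rank can only drop modulo
    2. *)
Lemma multiplicity_F2 (R : realType) (T : finType) (A : 'M[int]_#|T|) (a : int)
    (m : T -> T -> 'F_2) :
  (forall i j, (A i j - a *+ (i == j))%:~R = m (enum_val i) (enum_val j)) ->
  (multiplicity (map_mx intr A : 'M[R]_#|T|) a%:~R <= \dim (lker (ffun_lin m)))%N.
Proof.
move=> mE; rewrite /multiplicity /eigenspace mxrank_ker.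
have := limg_ker_dim (ffun_lin m) fullv; rewrite capfv dimvf dim_ffun => dimE.
rewrite leq_subLR -[leqLHS]dimE addnC leq_add2r.
apply: leq_trans (dim_limg_rank m) _.
have -> : map_mx intr A - (a%:~R)%:M = map_mx intr (A - a%:M) :> 'M[R]_#|T|.
  by rewrite map_mxB map_scalar_mx.
apply: leq_trans (mxrank_int_F2 R _); rewrite leq_eqVlt; apply/orP; left.
by apply/eqP; congr (\rank _); apply/matrixP => i j; rewrite !mxE mE.
Qed.

(** * Parity arithmetic, unordered pairs and cyclic sequences *)

Lemma card_sig_in (T : finType) (A : {set T}) : #|{: {x | x \in A}}| = #|A|.
Proof. by rewrite card_sig; apply: eq_card. Qed.

Lemma F2_addrr (x : 'F_2) : x + x = 0.
Proof. by case: x => [[|[|//]] ?]; apply: val_inj. Qed.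

Lemma F2_eq1 (x : 'F_2) : x != 0 -> x = 1.
Proof. by case: x => [[|[|//]] ?] // _; apply: val_inj. Qed.

Lemma F2_natr (n : nat) : n%:R = (odd n)%:R :> 'F_2.
Proof.
elim: n => // n IHn; rewrite -natr1 IHn /=.
by case: (odd n); rewrite ?add0r //= F2_addrr.
Qed.

Lemma F2_natr_eq0 (n : nat) : (n%:R == 0 :> 'F_2) = ~~ odd n.
Proof. by rewrite F2_natr; case: (odd n). Qed.

Lemma sum_setpair (T : finType) (V : zmodType) (u v : T) (G : T -> V) :
  u != v -> \sum_(w in [set u; v]) G w = G u + G v.
Proof. by move=> uv; rewrite big_setU1 ?inE //= big_set1. Qed.

Lemma setpair_inj (T : finType) (u : T) : injective (fun v => [set u; v]).
Proof.
move=> v w eq_uvw; have: v \in [set u; w] by rewrite -eq_uvw !inE eqxx orbT.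
have: w \in [set u; v] by rewrite eq_uvw !inE eqxx orbT.
by rewrite !inE => /orP[/eqP->|/eqP->//]; rewrite orbb => /eqP.
Qed.

(** After rotating [x] to the front, the first three entries are distinct. This will make the edges
    of a cycle distinct. *)
Lemma next_next_neq (T : eqType) (p : seq T) (x : T) :
  (2 < size p)%N -> uniq p -> x \in p -> next p (next p x) != x.
Proof.
move=> p_gt2 Up /rot_to[i s rotp]; rewrite -!(next_rot i Up).
have: uniq (rot i p) by rewrite rot_uniq.
have: (2 < size (rot i p))%N by rewrite size_rot.
rewrite rotp; case: s {rotp} => [|y [|z s]] //= _ /and3P[].
rewrite !inE !negb_or !eqxx => /and3P[xy xz _] _ _.
by rewrite (eq_sym y) (negbTE xy) eq_sym xz.
Qed.

(** * Edges, cuts and the incidence maps modulo 2 *)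

Section Graph.
Variables (T : finType) (e : rel T).
Hypotheses (e_sym : symmetric e) (e_irr : irreflexive e).

Lemma edge_neq u v : e u v -> u != v.
Proof. by apply: contraTneq => ->; rewrite e_irr. Qed.

Lemma mem_edges u v : ([set u; v] \in edges e) = e u v.
Proof.
rewrite inE; apply/existsP/idP => [[a /existsP[b /andP[ab /eqP uvab]]]|uv]; last first.
  by exists u; apply/existsP; exists v; rewrite uv eqxx.
have: a \in [set u; v] by rewrite uvab !inE eqxx.
have: b \in [set u; v] by rewrite uvab !inE eqxx orbT.
rewrite !inE => /orP[] /eqP bE /orP[] /eqP aE;
  by move: ab; rewrite aE bE ?e_irr // e_sym.
Qed.

Lemma edgeP f : reflect (exists u v, e u v /\ f = [set u; v]) (f \in edges e).
Proof.
rewrite inE; apply: (iffP existsP) => [[u /existsP[v /andP[uv /eqP fE]]]|].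
  by exists u, v.
by case=> u [v [uv ->]]; exists u; apply/existsP; exists v; rewrite uv eqxx.
Qed.

Lemma edges_at u :
  [set f in edges e | u \in f] = [set [set u; v] | v in [set v | e u v]].
Proof.
apply/setP => f; rewrite inE; apply/andP/imsetP => [[/edgeP[a [b [ab ->]]]]|].
  rewrite !inE => /orP[]/eqP->; first by exists b; rewrite ?inE.
  by exists a; rewrite ?inE 1?e_sym // setUC.
by case=> v; rewrite inE => uv ->; rewrite mem_edges uv !inE eqxx.
Qed.

Lemma sum_edges_at (V : zmodType) u (G : {set T} -> V) :
  \sum_(f in edges e | u \in f) G f = \sum_(v | e u v) G [set u; v].
Proof.
rewrite (eq_bigl (mem [set f in edges e | u \in f])) => [|f]; last by rewrite !inE.
rewrite edges_at big_imset /=; first by apply: eq_bigl => v; rewrite inE.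
by move=> v w _ _; apply: setpair_inj.
Qed.

Lemma cut_pair (U : {set T}) u v :
  e u v -> ([set u; v] \in cut e U) = ((u \in U) (+) (v \in U)).
Proof.
move=> uv; rewrite inE mem_edges uv /=.
apply/existsP/idP => [[a /andP[aU /existsP[b /andP[]]]]|].
  rewrite inE => bU /eqP uvab.
  have: a \in [set u; v] by rewrite uvab !inE eqxx.
  have: b \in [set u; v] by rewrite uvab !inE eqxx orbT.
  have: u \in [set a; b] by rewrite -uvab !inE eqxx.
  have: v \in [set a; b] by rewrite -uvab !inE eqxx orbT.
  rewrite !inE => vab uab buv auv; move: aU bU; move: uv.
  by case/orP: vab => /eqP->; case/orP: uab => /eqP->;
    rewrite ?e_irr // => _ -> /negbTE->.
have [uU /= vU|uU /= vU] := boolP (u \in U).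
  by exists u; rewrite uU; apply/existsP; exists v; rewrite inE vU eqxx.
by exists v; rewrite vU; apply/existsP; exists u; rewrite inE uU setUC eqxx.
Qed.

(** Common shape modulo 2 of the matrices minus [lam]: [pred0] gives A, [predT] gives A + I, odd
    degrees give L = Q, even degrees give L + I. *)
Definition adj_diag (b : pred T) := ffun_lin
  (fun u v : T => (e u v)%:R + ((u == v) && b u)%:R : 'F_2).

Definition laplacian_F2 := adj_diag (fun u => odd (degree e u)).

(** The incidence matrix modulo 2; [boundary] is its transpose. *)
Definition coboundary := ffun_lin
  (fun (f : {f | f \in edges e}) v => (v \in val f)%:R : 'F_2).

Definition boundary := ffun_lin
  (fun v (f : {f | f \in edges e}) => (v \in val f)%:R : 'F_2).

Lemma adj_diagE b x u :
  adj_diag b x u = \sum_(v | e u v) x v + (b u)%:R * x u.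
Proof.
rewrite ffun_linE; under eq_bigr do rewrite mulrDl.
rewrite big_split /=; apply: (congr2 +%R).
  by rewrite [RHS]big_mkcond; apply: eq_bigr => v _; case: e; rewrite ?mul1r ?mul0r.
rewrite (bigD1 u) //= eqxx big1 ?addr0 //.
by move=> v /negbTE; rewrite eq_sym => ->; rewrite mul0r.
Qed.

Lemma coboundaryE x f : coboundary x f = \sum_(v in val f) x v.
Proof.
rewrite ffun_linE [RHS]big_mkcond; apply: eq_bigr => v _.
by case: (v \in _); rewrite ?mul1r ?mul0r.
Qed.

Lemma boundaryE y u : boundary y u = \sum_(f : {f | f \in edges e} | u \in val f) y f.
Proof.
rewrite ffun_linE [RHS]big_mkcond; apply: eq_bigr => v _.
by case: (u \in _); rewrite ?mul1r ?mul0r.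
Qed.

(** Each edge uv at [u] contributes [x u + x v], and the copies of [x u] add up to the parity of the
    degree times [x u]. *)
Lemma boundary_coboundary : (boundary \o coboundary)%VF = laplacian_F2.
Proof.
apply/lfunP => x; apply/ffunP => u; rewrite comp_lfunE boundaryE adj_diagE.
under eq_bigr do rewrite coboundaryE.
rewrite -(big_sub_cond (edges e) (fun f => u \in f) (fun f => \sum_(v in f) x v)).
rewrite sum_edges_at addrC -F2_natr /degree.
under eq_bigr => v uv do rewrite sum_setpair ?edge_neq //.
rewrite big_split /=; apply: (congr2 +%R); last by [].
by rewrite sumr_const cardsE mulr_natl.
Qed.

(** * The cycle space as a kernel and the cut space as an image *)

Lemma edge_spaceE (y : edge_space e) :
  exists2 F : {set {set T}}, F \subset edges e & y = indicator e F.
Proof.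
exists [set val f | f in [set f | y f != 0]].
  by apply/subsetP => _ /imsetP[f _ ->]; apply: valP.
apply/ffunP => f; rewrite ffunE mem_imset; last exact: val_inj.
by rewrite inE; case: eqVneq => [->|/F2_eq1].
Qed.

(** The boundary of an indicator counts, modulo 2, the edges at each vertex. *)
Lemma cycle_spaceE : cycle_space e = lker boundary.
Proof.
apply/vspaceP => y; have [F sF ->] := edge_spaceE y.
rewrite mem_cycle_space // memv_ker.
have bE u : boundary (indicator e F) u = #|[set f in F | u \in f]|%:R.
  rewrite boundaryE; under eq_bigr do rewrite ffunE.
  rewrite -(big_sub_cond (edges e) (fun f => u \in f) (fun f => (f \in F)%:R)).
  rewrite -sum1_card natr_sum [LHS]big_mkcond [RHS]big_mkcond /=.
  apply: eq_bigr => f _; rewrite [in RHS]inE.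
  by have [/(subsetP sF)->|_] := boolP (f \in F); last case: ifP.
apply/forallP/eqP => [oF|/ffunP bF u].
  by apply/ffunP => u; rewrite bE ffunE; apply/eqP; rewrite F2_natr_eq0.
by rewrite -F2_natr_eq0 -bE bF ffunE.
Qed.

Lemma indicator_cut (U : {set T}) :
  indicator e (cut e U) = coboundary [ffun v => (v \in U)%:R].
Proof.
apply/ffunP => f; rewrite ffunE coboundaryE.
have /edgeP[u [v [uv ->]]] := valP f.
rewrite sum_setpair ?edge_neq // cut_pair // !ffunE.
by case: (u \in U); case: (v \in U); rewrite /= ?addr0 ?add0r ?F2_addrr.
Qed.

(** Every function to F_2 is the indicator of its support, so coboundaries are exactly the
    indicators of cuts. *)
Lemma cut_spaceE : cut_space e = limg coboundary.
Proof.
apply/eqP; rewrite eqEsubv; apply/andP; split.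
  by apply/span_subvP => _ /imageP[U _ ->]; rewrite indicator_cut memv_img ?memvf.
apply/subvP => _ /memv_imgP[x _ ->].
have -> : x = [ffun v => (v \in [set v | x v != 0])%:R].
  by apply/ffunP => v; rewrite ffunE inE; case: eqVneq => [->|/F2_eq1].
by rewrite -indicator_cut memv_span //; apply: image_f.
Qed.

(** * Connected components and the kernel of the coboundary *)

Lemma components_partition : partition (components e) [set: T].
Proof.
apply: equivalence_partitionP => u v w _ _ _; split; first exact: connect0.
by move=> uv; apply: same_connect uv w; apply: sym_connect_sym.
Qed.

Lemma mem_component (C : {set T}) u v :
  C \in components e -> u \in C -> (v \in C) = connect e u v.
Proof.
have eqv : {in [set: T] & &, equivalence_rel (connect e)}.
  move=> x y z _ _ _; split; first exact: connect0.
  by move=> xy; apply: same_connect xy z; apply: sym_connect_sym.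
move=> Cc uC; rewrite -(pblock_equivalence_partition eqv) ?inE //.
by rewrite (def_pblock (partition_trivIset components_partition) Cc uC).
Qed.

Lemma component_edge (C : {set T}) u v :
  C \in components e -> e u v -> (u \in C) = (v \in C).
Proof.
move=> Cc uv; apply/idP/idP => [uC|vC].
  by rewrite (mem_component _ Cc uC) connect1.
by rewrite (mem_component _ Cc vC) connect1 // e_sym.
Qed.

Lemma component_neq0 (C : {set T}) : C \in components e -> exists u, u \in C.
Proof.
by move=> Cc; apply/set0Pn; apply: partition_neq0 Cc; apply: components_partition.
Qed.

(** Combinations of indicators of components; [P] will be all components, then the non-even ones. *)
Definition spread (P : {set {set T}}) := ffun_lin
  (fun v (C : {C | C \in P}) => (v \in val C)%:R : 'F_2).

Section Spread.
Variable P : {set {set T}}.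
Hypothesis sP : P \subset components e.

Lemma spread_in x (C : {C | C \in P}) v : v \in val C -> spread P x v = x C.
Proof.
move=> vC; rewrite ffun_linE (bigD1 C) //= vC mul1r big1 ?addr0 // => D DC.
rewrite (_ : (v \in val D) = false) ?mul0r //; apply: contraNF DC => vD.
have Cc := subsetP sP _ (valP C); have Dc := subsetP sP _ (valP D).
have trI := partition_trivIset components_partition.
by apply/eqP/val_inj; rewrite -(def_pblock trI Cc vC) -(def_pblock trI Dc vD).
Qed.

Lemma limg_spread : (limg (spread P) <= lker coboundary)%VS.
Proof.
apply/subvP => _ /memv_imgP[x _ ->]; apply/lker_ffunP => f.
rewrite coboundaryE; have /edgeP[u [v [uv ->]]] := valP f.
rewrite sum_setpair ?edge_neq // [X in X + _](_ : _ = spread P x v) ?F2_addrr //.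
rewrite !ffun_linE; apply: eq_bigr => C _.
by rewrite (component_edge _ uv) //; apply: subsetP sP _ (valP C).
Qed.

(** [f] will be the identity, to count all components, or the restriction to odd vertices, under
    which the non-even components stay independent. *)
Lemma dim_limg_spread (rT : vectType 'F_2) (f : 'Hom({ffun T -> ('F_2)^o}, rT)) :
  (forall x, f (spread P x) = 0 -> x = 0) ->
  \dim (f @: limg (spread P)) = #|P|.
Proof.
move=> inj; rewrite -limg_comp limg_dim_eq.
  by rewrite dimvf dim_ffun card_sig_in.
by apply/eqP; rewrite capfv -subv0; apply/subvP => x;
  rewrite memv_ker comp_lfunE memv0 => /eqP/inj ->.
Qed.

End Spread.

(** A zero coboundary means equal values along edges, hence on components, so the component
    indicators form a basis. *)
Lemma dim_lker_coboundary : \dim (lker coboundary) = nb_components e.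
Proof.
have sc := subxx (components e).
rewrite /nb_components -(dim_limg_spread (P := components e) (f := \1%VF)); last first.
  move=> x; rewrite id_lfunE => /ffunP x0; apply/ffunP => C; rewrite ffunE.
  have [u uC] := component_neq0 (valP C).
  by rewrite -(spread_in sc x uC) x0 ffunE.
rewrite lim1g; congr (\dim _); apply/eqP; rewrite eqEsubv limg_spread // andbT.
apply/subvP => x /lker_ffunP x0.
have xe u v : e u v -> x u = x v.
  move=> uv; have fE : [set u; v] \in edges e by rewrite mem_edges.
  have := x0 (exist (fun f => f \in edges e) _ fE).
  rewrite coboundaryE /=.
  rewrite sum_setpair ?edge_neq //.
  move/eqP; rewrite addr_eq0 => /eqP->; apply/eqP.
  by rewrite eq_sym -subr_eq0 opprK F2_addrr.
have xc u v : connect e u v -> x u = x v.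
  move=> uv; have cl : closed e [pred w | x w == x u].
    by move=> w1 w2 /xe; rewrite !inE => ->.
  by have := closed_connect cl uv; rewrite !inE eqxx => /esym/eqP.
(* The value is read off at a picked vertex; the default 0 is never reached, components being
   nonempty. *)
pose val_on (C : {C | C \in components e}) : ('F_2)^o :=
  if [pick u in val C] is Some u then x u else 0.
pose y := [ffun C => val_on C].
suff -> : x = spread (components e) y by rewrite memv_img ?memvf.
apply/ffunP => v; have vc : pblock (components e) v \in components e.
  by apply: pblock_mem; rewrite (cover_partition components_partition) inE.
have vv : v \in pblock (components e) v.
  by rewrite mem_pblock (cover_partition components_partition) inE.
rewrite (@spread_in _ sc y (exist (fun C => C \in components e) _ vc)) // ffunE /val_on /=.
case: pickP => [u uC|/(_ v)].
  by apply: xc; rewrite -(mem_component _ vc vv).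
by rewrite /= vv.
Qed.

(** * The kernel of the Laplacian modulo 2 *)

Lemma laplacian_ker x :
  (x \in lker laplacian_F2) = (coboundary x \in lker boundary).
Proof. by rewrite -boundary_coboundary memv_ker comp_lfunE -memv_ker. Qed.

Lemma lker_coboundary_sub : (lker coboundary <= lker laplacian_F2)%VS.
Proof.
apply/subvP => x x0; have dx0 : coboundary x = 0 by apply/eqP; rewrite -memv_ker.
by rewrite laplacian_ker dx0 mem0v.
Qed.

(** Rank-nullity for [coboundary] on ker L: its kernel there is the whole of [lker coboundary], and
    its image is the bicycle space. *)
Lemma dim_lker_laplacian :
  \dim (lker laplacian_F2) = (nb_components e + bicycle_dim e)%N.
Proof.
rewrite -(limg_ker_dim coboundary) -dim_lker_coboundary; congr addn.
  congr (\dim _); apply/capv_idPr/lker_coboundary_sub.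
rewrite /bicycle_dim /bicycle_space cycle_spaceE cut_spaceE.
congr (\dim _); apply/vspaceP => y.
rewrite memv_cap; apply/memv_imgP/andP.
  by case=> x; rewrite laplacian_ker => x0 ->; rewrite memv_img ?memvf.
by case=> y0 /memv_imgP[x _ yE]; exists x; rewrite // laplacian_ker -yE.
Qed.

(** * Bicycles and packings of odd cycles *)

Lemma cycle_edges F : is_cycle e F -> F \subset edges e.
Proof.
case/existsP=> n /existsP[p /and3P[n2 /andP[cp _] /eqP->]].
by apply/subsetP => _ /imsetP[u u_p ->]; rewrite mem_edges; apply: next_cycle.
Qed.

(** Each vertex of a cycle lies on exactly two of its edges, so its value is counted twice. *)
Lemma cycle_sum (F : {set {set T}}) (g : T -> 'F_2) :
  is_cycle e F -> \sum_(f in F) \sum_(u in f) g u = 0.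
Proof.
case/existsP=> n /existsP[p /and3P[n2 /andP[cp Up] /eqP->]].
rewrite big_imset /=; last first.
  (* Two positions giving the same edge would be successors of each other, which [next_next_neq]
     excludes. *)
  move=> u v uin vin eq_uv; apply/eqP/negPn/negP => uv.
  have: u \in [set v; next p v] by rewrite -eq_uv !inE eqxx.
  have: v \in [set u; next p u] by rewrite eq_uv !inE eqxx.
  rewrite !inE [v == u]eq_sym (negbTE uv) /= => /eqP vE /eqP uE.
  have := @next_next_neq _ p u; rewrite size_tuple => /(_ n2 Up uin).
  by rewrite -vE -uE eqxx.
under eq_bigr => u uin do rewrite sum_setpair ?edge_neq ?(next_cycle cp uin) //.
rewrite big_split /= -[X in _ + X](big_uniq _ Up) (eq_bigl (mem p)) //.
rewrite -[X in X + _](big_uniq _ Up) -(big_map (next p) predT g).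
(* [next p] permutes the vertices of the cycle, so the two sums are equal and cancel. *)
rewrite (perm_big p) ?F2_addrr //; apply: uniq_perm => //.
  by rewrite map_inj_uniq //; apply: can_inj (prev_next Up).
move=> u; apply/mapP/idP => [[v vin ->]|uin]; first by rewrite mem_next.
by exists (prev p u); rewrite ?mem_prev ?next_prev.
Qed.

(** Rank-nullity on the cycle space for [phi], the parity of the intersection with each cycle of
    [P]. *)
Lemma bicycle_packing (P : {set {set {set T}}}) :
  odd_cycle_packing e P -> (bicycle_dim e + #|P| <= circuit_rank e)%N.
Proof.
case/andP=> /forallP oP tP.
have {}oP F : F \in P -> is_cycle e F /\ odd #|F|.
  by move=> FP; have := oP F; rewrite FP => /andP.
pose phi := ffun_lin (fun (F : {F | F \in P}) (f : {f | f \in edges e}) =>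
  (val f \in val F)%:R : 'F_2).
rewrite /circuit_rank -(limg_ker_dim phi); apply: leq_add.
  (* A cut is a coboundary, so its pairing with a cycle vanishes by [cycle_sum]. *)
  apply: dimvS; rewrite subv_cap capvSl /=.
  apply/subvP => y; rewrite memv_cap cut_spaceE => /andP[_ /memv_imgP[x _ ->]].
  apply/lker_ffunP => F; rewrite ffun_linE.
  have [cF _] := oP _ (valP F).
  rewrite -[RHS](cycle_sum x cF); under eq_bigr do rewrite coboundaryE.
  rewrite -(big_sub (edges e) (fun f => (f \in val F)%:R * \sum_(v in f) x v)).
  rewrite [LHS]big_mkcond [RHS]big_mkcond; apply: eq_bigr => f _.
  have [/(subsetP (cycle_edges cF))->|_] := boolP (f \in val F); first by rewrite mul1r.
  by rewrite mul0r if_same.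
rewrite (_ : (phi @: _)%VS = fullv) ?dimvf ?dim_ffun ?card_sig_in //.
apply: ffun_fullv => F; have [cF oF] := oP _ (valP F).
(* The cycles of [P] are dual to themselves: each has odd length, and distinct ones share no
   edge. *)
suff -> : [ffun G => (G == F)%:R] = phi (indicator e (val F)).
  rewrite memv_img // cycle_spaceE; apply/lker_ffunP => u.
  (* For the delta function at [u], [cycle_sum] counts the edges of the cycle at [u]. *)
  rewrite boundaryE -[RHS](cycle_sum (fun v => (v == u)%:R) cF).
  under eq_bigr do rewrite ffunE.
  rewrite -(big_sub_cond (edges e) (fun f => u \in f) (fun f => (f \in val F)%:R)).
  rewrite [LHS]big_mkcond [RHS]big_mkcond; apply: eq_bigr => f _.
  have [/(subsetP (cycle_edges cF))->|_] := boolP (f \in val F); last first.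
    by case: ifP.
  rewrite /=; case: ifP => [uf|uf]; last first.
    by rewrite big1 // => v vf; case: eqVneq => // vu; rewrite -vu vf in uf.
  by rewrite (bigD1 u) //= eqxx big1 ?addr0 // => v /andP[_ /negbTE->].
apply/ffunP => G; rewrite ffunE ffun_linE.
under eq_bigr do rewrite ffunE.
rewrite -(big_sub (edges e) (fun f => (f \in val G)%:R * (f \in val F)%:R : 'F_2)).
have -> : \sum_(f in edges e) (f \in val G)%:R * (f \in val F)%:R
   = #|val G :&: val F|%:R :> 'F_2.
  rewrite -sum1_card natr_sum [LHS]big_mkcond [RHS]big_mkcond; apply: eq_bigr => f _.
  rewrite [in RHS]inE -natrM mulnb andbC.
  by have [/(subsetP (cycle_edges cF))->|_] := boolP (f \in val F); case: ifP.
case: eqVneq => [->|GF]; first by rewrite setIid F2_natr oF.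
suff -> : val G :&: val F = set0 by rewrite cards0.
apply/eqP; rewrite setI_eq0; apply: (trivIsetP tP); [exact: valP|exact: valP|].
by apply: contra_neq GF => /val_inj.
Qed.

Lemma odd_cycle_packing_bound :
  (bicycle_dim e + odd_cycle_packing_number e <= circuit_rank e)%N.
Proof.
(* This allows [bicycle_dim] to cross the truncated subtraction. *)
have bc : (bicycle_dim e <= circuit_rank e)%N by rewrite dimvS // capvSl.
rewrite -leq_subRL //; apply/bigmax_leqP => P oP.
by rewrite leq_subRL // bicycle_packing.
Qed.

(** * Kernels of the adjacency matrix with a diagonal modulo 2 *)

Definition restrict (A : {set T}) := ffun_lin
  (fun (u : {u | u \in A}) v => (v == val u)%:R : 'F_2).

Lemma restrictE (A : {set T}) x u : restrict A x u = x (val u).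
Proof.
rewrite ffun_linE (bigD1 (val u)) //= eqxx mul1r big1 ?addr0 // => v /negbTE->.
by rewrite mul0r.
Qed.

Lemma restrict_eq0 (A : {set T}) (x : {ffun T -> ('F_2)^o}) :
  reflect {in A, forall u, x u = 0} (x \in lker (restrict A)).
Proof.
apply: (iffP (lker_ffunP _ _)) => [x0 u uA|x0 u].
  by have := x0 (exist (fun u => u \in A) _ uA); rewrite restrictE.
by rewrite restrictE x0 //; apply: valP.
Qed.

(** The equations of L and L + I at [u] differ by [x u], so the two kernels form a direct sum. *)
Lemma adj_diag_complement :
  (\dim (lker (adj_diag (fun u => ~~ odd (degree e u)))) +
     (nb_components e + bicycle_dim e) <= #|T|)%N.
Proof.
rewrite -dim_lker_laplacian -dimv_disjoint_sum ?dim_ffunv //.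
apply/eqP; rewrite -subv0; apply/subvP => x /memv_capP[/lker_ffunP x0 /lker_ffunP x1].
rewrite memv0; apply/eqP/ffunP => u.
move: (x0 u) (x1 u); rewrite !adj_diagE ffunE.
case: (odd _); rewrite /= mul0r addr0 mul1r.
  by move=> ->; rewrite add0r.
by move=> + s0; rewrite s0 add0r.
Qed.

(** Rank-nullity for the restriction to even-degree vertices: its kernel in ker (A + I) lies in ker
    L. *)
Lemma adj_diag_odd :
  (\dim (lker (adj_diag predT)) <=
     nb_components e + bicycle_dim e + nb_even_vertices e)%N.
Proof.
rewrite -dim_lker_laplacian.
rewrite -[leqLHS](limg_ker_dim (restrict [set u | ~~ odd (degree e u)])).
apply: leq_add; last by apply: leq_trans (dim_ffunv _) _; rewrite card_sig_in.
apply: dimvS; apply/subvP => x /memv_capP[/lker_ffunP x0 /restrict_eq0 x_even].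
apply/lker_ffunP => u; rewrite -(x0 u) !adj_diagE; have [|/= ou] := boolP (odd _) => //.
by rewrite x_even ?inE // !mulr0.
Qed.

(** Rank-nullity for [rho] on ker A: kernel and image each gain the number of non-even components.
    Doubled terms on both sides avoid subtraction. *)
Lemma adj_diag_even :
  (\dim (lker (adj_diag pred0)) + (nb_components e).*2 <=
     nb_components e + bicycle_dim e + nb_odd_vertices e
       + (nb_even_components e).*2)%N.
Proof.
pose Vo := [set u | odd (degree e u)]; pose rho := restrict Vo.
pose NE := [set C in components e | ~~ [forall x in C, ~~ odd (degree e x)]].
have sNE : NE \subset components e by apply/subsetP => C; rewrite inE => /andP[].
have oNE C : C \in NE -> exists2 u, u \in C & u \in Vo.
  rewrite inE => /andP[_]; rewrite negb_forall => /existsP[u].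
  by rewrite negb_imply negbK => /andP[uC ou]; exists u; rewrite ?inE.
have cE : nb_components e = (nb_even_components e + #|NE|)%N.
  rewrite /nb_components.
  rewrite -(cardsID [set C : {set T} | [forall x in C, ~~ odd (degree e x)]]).
  by congr (_ + _)%N; apply: eq_card => C; rewrite !inE // andbC.
(* The image of ker L under [rho] contains the restricted indicators of [NE], independent since each
   such component has an odd vertex. *)
have kerL : (\dim (lker laplacian_F2 :&: lker rho) + #|NE|
               <= \dim (lker laplacian_F2))%N.
  rewrite -[leqRHS](limg_ker_dim rho) leq_add2l.
  rewrite -(dim_limg_spread (P := NE) (f := rho)); last first.
    move=> x rx0; apply/ffunP => C; have [u uC uo] := oNE _ (valP C).
    rewrite -(spread_in sNE _ uC) ffunE.
    by have /restrict_eq0 -> : spread NE x \in lker rho by rewrite memv_ker rx0.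
  apply/dimvS/limgS/(subv_trans (limg_spread sNE)).
  exact: lker_coboundary_sub.
(* Sums over the odd vertices of each non-even component; a delta at one odd vertex of each shows
   that [sigma] is onto. *)
pose sigma := ffun_lin (fun (C : {C | C \in NE}) (u : {u | u \in Vo}) =>
  (val u \in val C)%:R : 'F_2).
have dim_sigma : (\dim (lker sigma) + #|NE|)%N = nb_odd_vertices e.
  rewrite -[RHS](card_sig_in Vo) -(dim_ffun 'F_2) -[RHS]dimvf.
  rewrite -[RHS](limg_ker_dim sigma) capfv.
  congr addn; rewrite (_ : limg sigma = fullv) ?dimvf ?dim_ffun ?card_sig_in //.
  apply: ffun_fullv => C; have [u uC uo] := oNE _ (valP C).
  pose v := exist (fun u => u \in Vo) _ uo.
  suff -> : [ffun D => (D == C)%:R] = sigma [ffun w => (w == v)%:R].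
    by rewrite memv_img ?memvf.
  apply/ffunP => D; rewrite ffun_linE (bigD1 v) //= !ffunE eqxx mulr1.
  rewrite big1 ?addr0; last first.
    by move=> w /negbTE wv; rewrite ffunE wv mulr0.
  congr (nat_of_bool _)%:R; apply/eqP/idP => [-> //|uD]; apply: val_inj.
  have trI := partition_trivIset components_partition.
  have Cc := subsetP sNE _ (valP C); have Dc := subsetP sNE _ (valP D).
  by rewrite -(def_pblock trI Cc uC) -(def_pblock trI Dc uD).
have kerA : (\dim (lker (adj_diag pred0)) <=
    \dim (lker laplacian_F2 :&: lker rho) + \dim (lker sigma))%N.
  rewrite -[leqLHS](limg_ker_dim rho); apply: leq_add; apply: dimvS.
    apply/subvP => x x_ker; apply/memv_capP; split; last by case/memv_capP: x_ker.
    case/memv_capP: x_ker => [/lker_ffunP x0 /restrict_eq0 x_odd].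
    apply/lker_ffunP => u; rewrite -(x0 u) !adj_diagE; have [|//] := boolP (odd _).
    by move=> ou; rewrite x_odd ?inE // !mulr0.
  apply/subvP => _ /memv_imgP[x /lker_ffunP x0 ->].
  apply/lker_ffunP => C; rewrite ffun_linE.
  have Cc := subsetP sNE _ (valP C).
  under eq_bigr do rewrite restrictE.
  rewrite -(big_sub Vo (fun u => (u \in val C)%:R * x u)).
  (* Modulo 2, summing over the odd vertices of the component is weighting each of its vertices by
     its degree; exchanging the sums leaves the values of A x, which are 0. *)
  transitivity (\sum_u \sum_(v | e u v) (u \in val C)%:R * x u).
    rewrite big_mkcond; apply: eq_bigr => u _; rewrite sumr_const inE.
    rewrite -[RHS]mulr_natl (_ : #|_| = degree e u); last by rewrite /degree cardsE.
    rewrite [X in _ = X * _]F2_natr.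
    by case: (odd _); rewrite ?mul1r ?mul0r.
  rewrite (exchange_big_dep predT) //= big1 // => v _.
  rewrite (eq_bigl (e v)) => [|u]; last by rewrite e_sym.
  under eq_bigr => u uv do rewrite -(component_edge Cc uv).
  have := x0 v; rewrite adj_diagE mul0r addr0 -big_distrr /= => ->.
  by rewrite mulr0.
move: dim_lker_laplacian cE kerL dim_sigma kerA; lia.
Qed.

(** * From real multiplicities to kernels modulo 2 *)

(** The sign [s] is 1 for A and Q and -1 for L; it disappears modulo 2. *)
Lemma multiplicity_adj_diag (R : realType) (M : 'M[R]_#|T|) (d : T -> int)
    (s lam : int) (b : pred T) :
  (forall i j, M i j =
     (d (enum_val i) *+ (i == j) + s * (e (enum_val i) (enum_val j))%:R)%:~R) ->
  s%:~R = 1 :> 'F_2 -> (forall u, (d u - lam)%:~R = (b u)%:R :> 'F_2) ->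
  (multiplicity M lam%:~R <= \dim (lker (adj_diag b)))%N.
Proof.
move=> ME s1 db.
pose N : 'M[int]_#|T| := \matrix_(i, j)
  (d (enum_val i) *+ (i == j) + s * (e (enum_val i) (enum_val j))%:R).
have -> : M = map_mx intr N by apply/matrixP => i j; rewrite !mxE ME.
apply: multiplicity_F2 => i j; rewrite mxE (inj_eq enum_val_inj) addrAC -mulrnBl.
rewrite rmorphD rmorphMn rmorphM /= s1 mul1r db rmorph_nat addrC.
by case: (i == j); case: (b _).
Qed.

Lemma F2_intr (m : int) : m%:~R = (~~ (2 %| m)%Z)%:R :> 'F_2.
Proof.
rewrite dvdzE dvdn2 negbK -F2_natr; case: m => // n.
by rewrite NegzE mulrNz abszN; apply/eqP; rewrite eq_sym -subr_eq0 opprK F2_addrr.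
Qed.

End Graph.

Theorem theorem1 (R : realType) (T : finType) (e : rel T)
    (e_sym : symmetric e) (e_irr : irreflexive e) (lam : int) :
  let m (M : 'M[R]_#|T|) : int := (multiplicity M lam%:~R)%:Z in
  let mA := m (adjacency_mx e R) in
  let mL := m (laplacian_mx e R) in
  let mQ := m (signless_laplacian_mx e R) in
  let theta : int := (circuit_rank e)%:Z in
  let tau : int := (odd_cycle_packing_number e)%:Z in
  let beta : int := (bicycle_dim e)%:Z in
  let v : int := (#|T|)%:Z in
  let c : int := (nb_components e)%:Z in
  let ce : int := (nb_even_components e)%:Z in
  let vo : int := (nb_odd_vertices e)%:Z in
  let ve : int := (nb_even_vertices e)%:Z in
  let i : int := (non_even_index e)%:Z in
  [/\ (2 %| lam)%Z -> mA <= theta - tau + vo + 2 * ce - c + 2 * i,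
      ~~ (2 %| lam)%Z -> mA <= theta - tau + ve + c,
      (2 %| lam)%Z -> mL <= theta - tau + c /\ mQ <= theta - tau + c
    & ~~ (2 %| lam)%Z -> mL <= v - beta - c /\ mQ <= v - beta - c].
Proof.
have packing := odd_cycle_packing_bound e_sym e_irr.
have kerL := dim_lker_laplacian e_sym e_irr.
have boundA (b : pred T) : (forall u : T, (0 - lam)%:~R = (b u)%:R :> 'F_2) ->
    (multiplicity (adjacency_mx e R) lam%:~R <= \dim (lker (adj_diag e b)))%N.
  move=> lamb; apply: (multiplicity_adj_diag (d := fun=> 0) (s := 1)) => // i j.
  by rewrite !mxE mul0rn add0r mul1r rmorph_nat.
have degE (s : int) i j :
    degree_mx e R i j + s%:~R * adjacency_mx e R i j
      = ((degree e (enum_val i))%:Z *+ (i == j) +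
         s * (e (enum_val i) (enum_val j))%:R)%:~R.
  by rewrite !mxE rmorphD rmorphMn rmorphM /= rmorph_nat -pmulrn.
have boundL (b : pred T) : (forall u : T, ((degree e u)%:Z - lam)%:~R = (b u)%:R :> 'F_2) ->
    (multiplicity (laplacian_mx e R) lam%:~R <= \dim (lker (adj_diag e b)))%N.
  move=> lamb; apply: (multiplicity_adj_diag (s := -1) _ _ lamb) => [i j|].
    by rewrite -degE [LHS]mxE mulrN1z mulN1r; congr (_ + _); rewrite mxE.
  by rewrite F2_intr.
have boundQ (b : pred T) : (forall u : T, ((degree e u)%:Z - lam)%:~R = (b u)%:R :> 'F_2) ->
    (multiplicity (signless_laplacian_mx e R) lam%:~R <= \dim (lker (adj_diag e b)))%N.
  move=> lamb; apply: (multiplicity_adj_diag (s := 1) _ _ lamb) => [i j|//].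
  by rewrite -degE [LHS]mxE mul1r.
have lamE : lam%:~R = (~~ (2 %| lam)%Z)%:R :> 'F_2 := F2_intr lam.
split=> lam2; rewrite lam2 /= in lamE.
(* A - [lam] reduces to A. With [packing], [adj_diag_even] gives theta - tau + vo + 2 ce - c, and
   [i] is nonnegative. *)
- have /boundA : forall u : T, (0 - lam)%:~R = (pred0 u)%:R :> 'F_2.
    by move=> u; rewrite rmorphB /= lamE subr0.
  have := adj_diag_even e_sym e_irr; lia.
- have /boundA : forall u : T, (0 - lam)%:~R = (predT u)%:R :> 'F_2.
    by move=> u; rewrite sub0r rmorphN /= lamE; apply: val_inj.
  have := adj_diag_odd e_sym e_irr; lia.
- have lamd u : ((degree e u)%:Z - lam)%:~R = (odd (degree e u))%:R :> 'F_2.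
    by rewrite rmorphB /= lamE subr0 -F2_natr.
  by move: (boundL _ lamd) (boundQ _ lamd); rewrite kerL; lia.
(* For odd [lam], both L - [lam] and Q - [lam] reduce to L + I. *)
have lamd u : ((degree e u)%:Z - lam)%:~R = (~~ odd (degree e u))%:R :> 'F_2.
  rewrite rmorphB /= lamE [X in X - _](F2_natr (degree e u)).
  by case: (odd _); apply: val_inj.
by move: (boundL _ lamd) (boundQ _ lamd) (adj_diag_complement e_sym e_irr); lia.
Qed.
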